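(* There is an absolute constant $C>0$ such that the following holds. Let $G=(V,E)$ be a 2-vertex-connected graph with $n=|V|\ge 2$ vertices, and let $a\in V$ be a specified vertex. Then for any two spanning trees $T,T'$ of $G$ there is a sequence of at most $C n^2$ spanning trees of $G$, beginning with $T$ and ending with $T'$, such that every pair of consecutive trees in the sequence are adjacent (with respect to $a$).
   Context: Given a connected graph $G=(V,E)$ with $n\ge 2$ vertices and a specified vertex $a\in V$, two spanning trees of $G$ are called adjacent if their intersection (the subgraph consisting of the edges common to both) contains a tree on $n-1$ vertices that includes $a$. Equivalently, viewing spanning trees as rooted at $a$, $T_B$ is adjacent to $T_A$ iff $T_B$ is obtained from $T_A$ by detaching some leaf $v\neq a$ of $T_A$ from its parent and attaching it to some vertex via an edge of $G$. *)

(* Defs.v *)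
(* A finite simple graph is a symmetric irreflexive relation
   [g : rel V] on a finType V; edges are 2-element vertex sets. *)
From mathcomp Require Import all_boot.
Set Implicit Arguments.
Unset Strict Implicit.
Unset Printing Implicit Defensive.

Section Graphs.
Variable V : finType.

Definition edges (g : rel V) : {set {set V}} :=
  [set [set x; y] | x in V, y in V & g x y].

Definition erel (W : {set V}) (F : {set {set V}}) : rel V :=
  [rel x y | [&& x \in W, y \in W & [set x; y] \in F]].

Definition connected_on (W : {set V}) (F : {set {set V}}) : Prop :=
  forall x y, x \in W -> y \in W -> connect (erel W F) x y.

Definition gconnected (g : rel V) : Prop := connected_on setT (edges g).

Definition two_connected (g : rel V) : Prop :=
  gconnected g /\ forall v : V, connected_on (~: [set v]) (edges g).

(* F is (the edge set of) a tree on the vertex set W: every edge of F is a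
   2-subset of W, (W,F) is connected, and (W,F) is acyclic, i.e. removing any
   edge f = {x,y} of F disconnects x from y. *)
Definition is_tree_on (W : {set V}) (F : {set {set V}}) : Prop :=
  [/\ forall f, f \in F -> (#|f| = 2 /\ f \subset W),
      connected_on W F &
      forall f x y, f \in F -> f = [set x; y] ->
        ~ connect (erel W (F :\ f)) x y].

Definition spanning_tree (g : rel V) (T : {set {set V}}) : Prop :=
  T \subset edges g /\ is_tree_on setT T.

(* Adjacency of spanning trees w.r.t. the root a: the intersection contains
   a tree on n-1 vertices that includes a, i.e. a tree on V \ {v} for some
   vertex v <> a. *)
Definition adjacent_trees (a : V) (T1 T2 : {set {set V}}) : Prop :=
  exists v : V, v <> a /\
    exists S : {set {set V}}, S \subset T1 :&: T2 /\ is_tree_on (~: [set v]) S.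

End Graphs.

(* Main.v *)
(* By ear insertions, a 2-connected graph has an ordering of V \ {a} in which
   every vertex v has a neighbour lo v that is a or earlier, and a neighbour
   hi v that is a or later. Root all trees at a. Every tree T is brought to the
   tree with parent function lo by growing a descendant-closed set D on which
   parents are given by lo. To add to D a vertex c <> a that is a leaf of the
   rest of T, run downwards through the vertices of D after c and give each the
   parent hi; each is a leaf at its turn. Then no vertex of D hangs from c:
   those before c use lo and those after c use hi. So c is a leaf and can be
   moved to lo c, after which the vertices after c go back to lo in increasing
   order. A stage takes at most 2n moves, hence all stages at most 2n^2, and
   adjacency is symmetric. *)
Require Import Defs.
From mathcomp Require Import all_boot zify.
Set Implicit Arguments.
Unset Strict Implicit.
Unset Printing Implicit Defensive.

(** * Unordered pairs and reachability in a relation *)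

Lemma set2_eq (T : finType) (x y x' y' : T) :
  [set x; y] = [set x'; y'] -> (x = x' /\ y = y') \/ (x = y' /\ y = x').
Proof.
move=> e.
have := set21 x y; rewrite e in_set2.
have := set22 x y; rewrite e in_set2.
have := set21 x' y'; rewrite -e in_set2.
have := set22 x' y'; rewrite -e in_set2.
by do 4!case/orP=> /eqP ?; subst; auto.
Qed.

Lemma connect_exit (T : finType) (e : rel T) (A : {pred T}) x y :
  connect e x y -> x \in A -> y \notin A ->
  exists u v, [/\ u \in A, v \notin A & e u v].
Proof.
case/connectP=> p pe ->; elim: p x pe => [|z p IH] x /=; first by move=> _ ->.
case/andP=> exz pz xA; have [zA|zA] := boolP (z \in A); first exact: IH.
by move=> _; exists x, z.
Qed.

(** Take for [r] the distance to [a]: the second vertex of a shortest path to [a] is strictly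
    nearer. *)
Lemma connect_parent (T : finType) (e : rel T) (a : T) :
  (forall x, connect e x a) ->
  exists p : T -> T, exists r : T -> nat,
    forall x, x != a -> e x (p x) /\ r (p x) < r x.
Proof.
move=> ca.
pose P x n := [exists t : n.-tuple T, path e x t && (last x t == a)].
have exP x : exists n, P x n.
  case/connectP: (ca x) => p pp ep; exists (size p).
  by apply/existsP; exists (in_tuple p); rewrite pp -ep /=.
pose r x := ex_minn (exP x).
have step x : x != a -> exists y, e x y && (r y < r x).
  move=> xa; rewrite {2}/r; case: ex_minnP => n /existsP[[t /= /eqP st]].
  case: t st => [|y t] /= <-; first by rewrite (negPf xa).
  case/andP=> /andP[exy pt] lt _; exists y; rewrite exy /= ltnS /r.
  case: ex_minnP => m _; apply; apply/existsP; exists (in_tuple t).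
  by rewrite pt.
exists (fun x => if [pick y | e x y && (r y < r x)] is Some y then y else x), r.
move=> x xa; case: pickP => [y /andP[]|no] //.
by case: (step x xa) => y; rewrite no.
Qed.

(** * Spanning trees as parent functions *)

Section LeafMoves.
Variables (V : finType) (g : rel V) (a : V).
Hypotheses (g_sym : symmetric g) (g_irr : irreflexive g).

Lemma mem_edges x y : ([set x; y] \in edges g) = g x y.
Proof.
apply/imset2P/idP => [[x' y' _]|gxy].
  by rewrite inE => /andP[_ gxy] /set2_eq[[-> ->]|[-> ->]] //; rewrite g_sym.
by exists x y; rewrite // inE gxy inE.
Qed.

Lemma erel_sym (W : {set V}) F : symmetric (erel W F).
Proof. by move=> x y; apply/and3P/and3P; rewrite setUC => -[]. Qed.

Lemma adjacent_trees_sym T1 T2 :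
  adjacent_trees a T1 T2 -> adjacent_trees a T2 T1.
Proof. by case=> v [va [S SP]]; exists v; split=> //; exists S; rewrite setIC. Qed.

(** The index only bounds the number of moves from above, since [reach_refl] is available at every
    [n]. *)
Inductive reach : nat -> {set {set V}} -> {set {set V}} -> Prop :=
| reach_refl n T : reach n T T
| reach_step n T U W :
    spanning_tree g U -> adjacent_trees a T U -> reach n U W -> reach n.+1 T W.

Lemma reach_leq m n T U : m <= n -> reach m T U -> reach n T U.
Proof.
move=> + r; elim: r n => {m T U} [m T|m T U W sU aU _ IH] [|n] //= mn.
1,2: exact: reach_refl.
by apply: reach_step aU _; last exact: IH.
Qed.

Lemma reach_trans m n T U W : reach m T U -> reach n U W -> reach (m + n) T W.
Proof.
elim=> {m T U} [m T|m T U U' sU aU _ IH] r; last first.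
  by rewrite addSn; apply: reach_step aU _ => //; exact: IH.
elim: r => {n T W} [n T|n T U W sU aU _ IH]; first exact: reach_refl.
by rewrite addnS; apply: reach_step IH.
Qed.

Lemma reach_sym n T U : spanning_tree g T -> reach n T U -> reach n U T.
Proof.
move=> sT r; elim: r sT => {n T U} [n T|n T U W sU aU _ IH] sT.
  exact: reach_refl.
rewrite -addn1; apply: reach_trans (IH sU) _.
exact: reach_step (adjacent_trees_sym aU) (reach_refl _ _).
Qed.

Lemma reach_seq n T U : reach n T U -> exists s : seq {set {set V}},
  [/\ size s <= n, forall S, S \in s -> spanning_tree g S,
      forall i, i < size s -> adjacent_trees a (nth T (T :: s) i) (nth T s i) &
      last T s = U].
Proof.
elim=> {n T U} [n T|n T U W sU aU _ [s [ss sp adj lst]]]; first by exists [::].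
exists (U :: s); split=> //.
  by move=> S; rewrite inE => /predU1P[->|/sp].
case=> [|i] //= lti; have := adj i lti.
by rewrite (set_nth_default T) ?(set_nth_default T (s := s)) //= ltnW.
Qed.

Definition parent_tree (W : {set V}) (p : V -> V) : {set {set V}} :=
  [set [set v; p v] | v in W :\ a].

Lemma parent_treeP (W : {set V}) (p : V -> V) f :
  reflect (exists2 v, v \in W :\ a & f = [set v; p v]) (f \in parent_tree W p).
Proof. exact: imsetP. Qed.

(** Following [p] lowers the rank until [a] is met. [F] is arbitrary so that the result also applies
    to a tree with one edge removed. *)
Lemma parent_tree_connected (W : {set V}) (p : V -> V) (r : V -> nat) (F : {set {set V}}) :
  a \in W ->
  (forall v, v \in W -> v != a ->
     [/\ p v \in W, r (p v) < r v & [set v; p v] \in F]) ->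
  connected_on W F.
Proof.
move=> aW H.
have toa x : x \in W -> connect (erel W F) x a.
  elim: {x}(r x).+1 {-2}x (ltnSn (r x)) => // n IH x lx xW.
  have [->|xa] := eqVneq x a; first exact: connect0.
  have [pW lp pF] := H x xW xa.
  apply: connect_trans (connect1 _) (IH (p x) (leq_trans lp lx) pW).
  by apply/and3P.
move=> x y xW yW; apply: connect_trans (toa x xW) _.
by rewrite (sym_connect_sym (erel_sym W F)) toa.
Qed.

Lemma parent_tree_is_tree (W : {set V}) (p : V -> V) (r : V -> nat) :
  a \in W -> p a = a ->
  (forall v, v \in W -> v != a -> p v \in W /\ r (p v) < r v) ->
  is_tree_on W (parent_tree W p).
Proof.
move=> aW pa H; split.
- move=> f /parent_treeP[v]; rewrite !inE => /andP[va vW] ->.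
  have [pW lp] := H v vW va; split; last by rewrite subUset !sub1set vW.
  by rewrite cards2; case: eqVneq lp => // <-; rewrite ltnn.
- apply: (parent_tree_connected (p := p) (r := r)) => // v vW va.
  have [pW lp] := H v vW va; split=> //.
  by apply/parent_treeP; exists v; rewrite // !inE va.
- move=> f x y /parent_treeP[v]; rewrite !inE => /andP[va vW] -> exy.
  have [pW lp] := H v vW va.
  (* The descendants of [v] are not joined to their complement. *)
  pose K := [pred u | fconnect p u v].
  have vK : v \in K by exact: connect0.
  have pK u : u \in K -> u != v -> p u \in K.
    case/connectP=> -[|w q] /=; first by move=> _ ->; rewrite eqxx.
    by case/andP=> /eqP -> pq ev _; apply/connectP; exists q.
  have itW k u : u \in W -> iter k p u \in W /\ r (iter k p u) <= r u.
    move=> uW; elim: k => //= k [kW kr].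
    have [ka|ka] := eqVneq (iter k p u) a; last first.
      by have [? l] := H _ kW ka; split=> //; exact: leq_trans (ltnW l) kr.
    by rewrite ka pa -ka.
  (* Iterates of [p] from [p v] have rank at most [r (p v) < r v], so they never meet [v]. *)
  have pvK : p v \notin K.
    apply/negP=> /iter_findex e; have [_] := itW (findex p (p v) v) _ pW.
    by rewrite e leqNgt lp.
  have vpv : ~ connect (erel W (parent_tree W p :\ [set v; p v])) v (p v).
    move=> c; have [u [w [uK wK]]] := connect_exit c vK pvK.
    case/and3P=> _ _ /setD1P[ne /parent_treeP[v' _ e]].
    have v'v : v' != v by apply: contraNneq ne => <-; rewrite e.
    case: (set2_eq e) => -[? ?]; subst u w; first by rewrite pK in wK.
    by case/negP: wK; apply: connect_trans (connect1 _) uK => /=.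
  case: (set2_eq exy) => -[<- <-] //.
  by rewrite (sym_connect_sym (erel_sym _ _)).
Qed.

(** The rank expresses acyclicity: every orbit of [p] descends to the fixed point [a]. *)
Definition rooted (p : V -> V) :=
  [/\ p a = a, forall v, v != a -> g v (p v) &
      exists r : V -> nat, forall v, v != a -> r (p v) < r v].

Lemma rooted_spanning p : rooted p -> spanning_tree g (parent_tree setT p).
Proof.
case=> pa gp [r rp]; split.
  apply/subsetP=> f /parent_treeP[v]; rewrite !inE andbT => va ->.
  by rewrite mem_edges gp.
by apply: (parent_tree_is_tree (r := r)) => // v _ va; rewrite inE rp.
Qed.

(** Parents come from distances to [a] inside [T]. An edge of [T] joining no vertex to its parent
    could be removed without disconnecting [T], against acyclicity. *)
Lemma spanning_rooted T :
  spanning_tree g T ->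
  exists p : {ffun V -> V}, rooted p /\ T = parent_tree setT p.
Proof.
case=> /subsetP Tg [T2 Tc Tacyc].
have [p [r H]] := connect_parent (fun x => Tc x a (in_setT x) (in_setT a)).
pose q := [ffun x => if x == a then a else p x].
have qE x : x != a -> q x = p x by rewrite ffunE => /negPf ->.
have qT x : x != a -> [set x; q x] \in T.
  by move=> xa; rewrite qE //; case: (H x xa) => /and3P[].
have qr x : x != a -> r (q x) < r x by move=> xa; rewrite qE //; case: (H x xa).
exists q; split.
  split; first by rewrite ffunE eqxx.
  - by move=> v va; rewrite -mem_edges; apply/Tg/qT.
  - by exists r.
apply/setP=> f; apply/idP/parent_treeP => [fT|[v]]; last first.
  by rewrite !inE andbT => va ->; exact: qT.
have [[/eqP/cards2P[x [y [xy fE]]] _]] := (T2 f fT, I).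
have [/existsP[v /andP[va /eqP e]]|no] :=
  boolP [exists v, (v != a) && (f == [set v; q v])].
  by exists v; rewrite // !inE va.
case: (Tacyc f x y fT fE).
apply: (parent_tree_connected (W := setT) (p := q) (r := r)); rewrite ?inE //.
move=> v _ va; rewrite !inE qr // qT // andbT; split=> //.
by apply: contra no => /eqP e; apply/existsP; exists v; rewrite va e /=.
Qed.

(** Since [p] and [p'] agree off the leaf [v], both trees contain the tree that [p] defines on the
    complement of [v]. *)
Lemma move_leaf (p p' : V -> V) v :
  rooted p -> v != a -> (forall u, p u != v) ->
  (forall u, u != v -> p' u = p u) -> g v (p' v) ->
  rooted p' /\ reach 1 (parent_tree setT p) (parent_tree setT p').
Proof.
move=> rp va leaf pp' gv; have [pa gp [r rr]] := rp.
have vp : p' v != v by apply: contraTneq gv => ->; rewrite g_irr.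
have rp' : rooted p'.
  split; first by rewrite pp' // eq_sym.
  - by move=> u ua; have [->|uv] := eqVneq u v; rewrite // pp' ?gp.
  (* [v] is ranked just above its new parent; being childless, it constrains no other rank. *)
  exists (fun u => if u == v then (r (p' v)).+1 else r u) => u ua.
  have [->|uv] := eqVneq u v; first by rewrite (negPf vp).
  by rewrite pp' // (negPf (leaf u)) rr.
split=> //; apply: reach_step (reach_refl _ _); first exact: rooted_spanning.
exists v; split; first exact/eqP.
exists (parent_tree (~: [set v]) p); split.
  rewrite subsetI; apply/andP; split; apply/subsetP=> f /parent_treeP[u].
    by rewrite !inE => /andP[ua uv] ->; apply/parent_treeP; exists u; rewrite // !inE ua.
  rewrite !inE => /andP[ua uv] ->; apply/parent_treeP; exists u; rewrite ?pp' //.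
  by rewrite !inE ua.
apply: (parent_tree_is_tree (r := r)); rewrite ?inE // 1?eq_sym //.
by move=> u _ ua; rewrite !inE leaf rr.
Qed.

(** Idle steps are allowed, so that time can run through all positions of a vertex order while only
    some vertices move. *)
Lemma sweep (P : nat -> {ffun V -> V}) n :
  (forall k, k < n -> P k.+1 = P k \/
     exists v, [/\ v != a, forall u, P k u != v,
                   forall u, u != v -> P k.+1 u = P k u & g v (P k.+1 v)]) ->
  rooted (P 0) ->
  rooted (P n) /\ reach n (parent_tree setT (P 0)) (parent_tree setT (P n)).
Proof.
move=> H r0; elim: n H => [|n IH] H; first by split=> //; exact: reach_refl.
have [k kn|rn Rn] := IH; first by apply: H; exact: ltnW.
have [->|[v [va leaf eqv gv]]] := H n (ltnSn n).
  by split=> //; have := reach_trans Rn (reach_refl 1 _); rewrite addn1.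
have [rn' Rn'] := move_leaf rn va leaf eqv gv.
by split=> //; have := reach_trans Rn Rn'; rewrite addn1.
Qed.

End LeafMoves.

(** * Bipolar orders of 2-connected graphs *)

Section Orders.
Variables (V : finType) (g : rel V) (a : V).
Hypothesis g_sym : symmetric g.

(* Every member of [t] has a neighbour before it and a neighbour after it in
   the concatenation of (the reversal of) [L], [t] and [R]. *)
Fixpoint bipolar (L t R : seq V) : bool :=
  if t is v :: t' then
    [&& has (g v) L, has (g v) (t' ++ R) & bipolar (v :: L) t' R]
  else true.

Lemma bipolar_sub L L' t R R' :
  {subset L <= L'} -> {subset R <= R'} -> bipolar L t R -> bipolar L' t R'.
Proof.
move=> LL RR; elim: t L L' LL => //= v t IH L L' LL.
case/and3P=> /hasP[x xL gx] /hasP[y yR gy] b; apply/and3P; split.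
- by apply/hasP; exists x; rewrite ?LL.
- apply/hasP; exists y => //; move: yR; rewrite !mem_cat => /orP[->|/RR->] //.
  by rewrite orbT.
- by apply: IH b => z; rewrite !inE => /orP[->|/LL->] //; rewrite orbT.
Qed.

Lemma bipolar_cat L t1 t2 R :
  bipolar L (t1 ++ t2) R = bipolar L t1 (t2 ++ R) && bipolar (rev t1 ++ L) t2 R.
Proof.
elim: t1 L => //= v t1 IH L.
by rewrite IH rev_cons cat_rcons catA !andbA.
Qed.

Lemma bipolar_rev L t R : bipolar L t R -> bipolar R (rev t) L.
Proof.
elim: t L => //= v t IH L /and3P[gL gR /IH b].
by rewrite rev_cons -cats1 bipolar_cat revK /= b gR gL.
Qed.

(** Each inner vertex of an ear has its predecessor on the left and its successor on the right; the
    last one uses [y]. *)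
Lemma bipolar_path u p y L R :
  path g u (rcons p y) -> y \in R -> bipolar (u :: L) p R.
Proof.
move=> + yR; elim: p u L => //= v p IH u L /andP[guv pp].
rewrite g_sym guv IH //= andbT.
case: p pp {IH} => [|w p] /= /andP[gv _]; last by rewrite gv.
by apply/hasP; exists y.
Qed.

(** The interior of an ear goes directly after its earlier end [u]; old vertices keep their
    neighbours on the same sides. *)
Lemma bipolar_insert s1 u p s2 y L R :
  bipolar L (s1 ++ u :: s2) R -> path g u (rcons p y) -> y \in s2 ++ R ->
  bipolar L (s1 ++ u :: p ++ s2) R.
Proof.
rewrite !bipolar_cat /= => /and3P[b1 gL /andP[gR b2]] pp yR.
have ps : {subset s2 ++ R <= (p ++ s2) ++ R}.
  by move=> z; rewrite !mem_cat => /orP[]->; rewrite ?orbT.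
apply/and4P; split => //.
- apply: bipolar_sub b1 => // z; rewrite !inE => /orP[->//|/ps->].
  by rewrite orbT.
- by case/hasP: gR => z /ps zR gz; apply/hasP; exists z.
rewrite bipolar_cat (bipolar_path _ pp) //=.
apply: bipolar_sub b2 => // z; rewrite mem_cat !inE => /orP[->|->]; rewrite ?orbT //.
Qed.

Hypothesis g_conn : two_connected g.

Lemma edges_rel (W : {set V}) x y :
  erel W (edges g) x y -> [/\ x \in W, y \in W & g x y].
Proof. by case/and3P; rewrite mem_edges. Qed.

(** An edge from a listed [u] to an unlisted [x], continued in the graph without [u] until the list
    is met again at [y], is an ear with distinct ends. *)
Lemma bipolar_extend s x0 :
  uniq (a :: s) -> bipolar [:: a] s [:: a] -> x0 \notin a :: s ->
  exists s', [/\ uniq (a :: s'), bipolar [:: a] s' [:: a] & size s < size s'].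
Proof.
move=> us bs x0s; have [conn conn1] := g_conn.
have [u [x [us' xs /edges_rel[_ _ gux]]]] :=
  connect_exit (conn a x0 (in_setT _) (in_setT _)) (mem_head a s) x0s.
move: (us') (xs); rewrite !inE => /predU1P[ua|{}us'] /norP[xa xs'].
  exists (x :: s); rewrite -ua in bs xa us *; split=> //.
    by move: us; rewrite /= !inE negb_or eq_sym xa xs'.
  rewrite /= g_sym gux has_cat /= g_sym gux orbT.
  by apply: bipolar_sub bs => z; rewrite !inE => /eqP ->; rewrite eqxx ?orbT.
have ua : u != a by apply: contraTneq us' => ->; case/andP: us.
have xu : x != u by apply: contraNneq xs' => ->.
have := conn1 u x a; rewrite !inE [a == u]eq_sym => /(_ xu ua).
case/connectP=> q0 /shortenP[q pq uq _] aq.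
have hq : has (mem (a :: s)) q.
  apply/hasP; exists a; rewrite ?inE ?eqxx //.
  by case: (q) aq xa => [|z q'] /= ->; rewrite ?eqxx ?mem_last.
(* [y] is the first listed vertex on the path, so all vertices of [p] are new. *)
case/split_find: hq pq uq {aq} => y p q2 ys /hasPn ps.
rewrite cat_path => /andP[pq _] uq.
have yu : y != u.
  by move: pq; rewrite rcons_path => /andP[_ /edges_rel[_]]; rewrite !inE.
have {}pq : path g x (rcons p y).
  by apply: sub_path pq => z t /edges_rel[].
have {}uq : uniq (x :: p).
  by move: uq; rewrite -cat_cons cat_uniq -rcons_cons rcons_uniq => /andP[/andP[]].
have dis : ~~ has (mem (x :: p)) (a :: s).
  apply/hasPn=> z zs; apply/negP; rewrite /= inE => /predU1P[zx|/ps/negP].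
    by rewrite -zx zs in xs.
  exact.
have up s' : perm_eq s' ((x :: p) ++ s) -> uniq (a :: s') /\ size s < size s'.
  move=> e; split; last by rewrite (perm_size e) /= size_cat ltnS leq_addl.
  have /perm_uniq -> : perm_eq (a :: s') ((x :: p) ++ (a :: s)).
    by rewrite perm_sym (perm_catCA (x :: p) [:: a] s) perm_cons perm_sym.
  by rewrite cat_uniq uq dis.
have pu : path g u (rcons (x :: p) y) by rewrite /= gux.
case/splitPr: us' us bs ys up {conn conn1 xs xs' ps dis}=> s1 s2 _ bs ys up.
have [y2|y1] := boolP (y \in s2 ++ [:: a]).
  have b := bipolar_insert bs pu y2.
  have [|us sz] := up (s1 ++ u :: (x :: p) ++ s2).
    by rewrite -(cat_rcons u) perm_catCA cat_rcons.
  by exists (s1 ++ u :: (x :: p) ++ s2).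
(* Here [y] precedes [u]; reversing the list keeps it bipolar and puts [y] after [u]. *)
have {}y1 : y \in rev s1 ++ [:: a].
  move: ys y1; rewrite !(mem_cat, inE) mem_rev (negPf yu) /=.
  by case: (y == a); case: (y \in s1); case: (y \in s2).
have := bipolar_rev bs; rewrite rev_cat rev_cons cat_rcons => {}bs.
have b := bipolar_insert bs pu y1.
have [|us sz] := up (rev s2 ++ u :: (x :: p) ++ rev s1).
  rewrite -(cat_rcons u) perm_catCA perm_cat2l cat_rcons perm_sym -perm_rev.
  by rewrite rev_cat rev_cons cat_rcons.
by exists (rev s2 ++ u :: (x :: p) ++ rev s1).
Qed.

(** This is an st-numbering with both poles at [a], read off from a bipolar list extended until it
    contains every vertex. *)
Lemma st_order :
  exists (sigma : V -> nat) (lo hi : V -> V),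
  [/\ injective sigma, forall v, sigma v < #|V|,
      forall v, v != a -> g v (lo v) /\ (lo v != a -> sigma (lo v) < sigma v) &
      forall v, v != a -> g v (hi v) /\ (hi v != a -> sigma v < sigma (hi v))].
Proof.
have [s [us bs full]] : exists s, [/\ uniq (a :: s), bipolar [:: a] s [:: a] &
    forall x, x \in a :: s].
  suff grow n : exists s, [/\ uniq (a :: s), bipolar [:: a] s [:: a] &
      n <= size s \/ forall x, x \in a :: s].
    have [s [us bs [sz|full]]] := grow #|V|; last by exists s.
    have := max_card (mem (a :: s)).
    by rewrite (card_uniqP us) leqNgt ltnS sz.
  elim: n => [|n [s [us bs [sz|full]]]]; [by exists [::]; split; auto | | by exists s; split; auto].
  have [/forallP full|/forallPn[x0 x0s]] := boolP [forall x, x \in a :: s].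
    by exists s; split; auto.
  have [s' [us' bs' sz']] := bipolar_extend us bs x0s.
  by exists s'; split=> //; left; exact: leq_ltn_trans sz'.
have nb v : v != a ->
  (exists w, g v w && ((w != a) ==> (index w s < index v s))) /\
  (exists w, g v w && ((w != a) ==> (index v s < index w s))).
  move=> va; have vs : v \in s by have := full v; rewrite inE (negPf va).
  move: us bs; case/splitPr: vs => s1 s2; rewrite cons_uniq => /andP[_ us].
  rewrite bipolar_cat /= => /and4P[_ /hasP[w ws gw] /hasP[w' ws' gw'] _].
  have v1 : v \notin s1.
    by move: us; rewrite cat_uniq => /and3P[_ /norP[]].
  have iv : index v (s1 ++ v :: s2) = size s1.
    by rewrite index_cat (negPf v1) /= eqxx addn0.
  rewrite iv; split; [exists w; rewrite gw | exists w'; rewrite gw'].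
    apply/implyP=> wa; move: ws; rewrite mem_cat mem_rev inE (negPf wa) orbF.
    by move=> w1; rewrite index_cat w1 index_mem.
  apply/implyP=> wa; move: ws'; rewrite mem_cat inE (negPf wa) orbF => w2.
  move: us; rewrite cat_uniq => /and3P[_ /hasPn d /= /andP[v2 _]].
  rewrite index_cat (negPf (d w' _)) ?inE ?w2 ?orbT //=.
  by case: eqP w2 v2 => [->->//|_ _ _]; rewrite addnS ltnS leq_addr.
(* [a] is not in [s], so its index is the default [size s], which no other vertex takes. *)
exists (index^~ s).
exists (fun v => odflt a [pick w | g v w && ((w != a) ==> (index w s < index v s))]).
exists (fun v => odflt a [pick w | g v w && ((w != a) ==> (index v s < index w s))]).
have cV : #|V| = (size s).+1.
  by rewrite -[(size s).+1]/(size (a :: s)) -(card_uniqP us); apply/esym/eq_card => x; rewrite full.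
split.
- apply: (can_inj (g := nth a s)) => x; have := full x; rewrite inE.
  case/predU1P=> [->|]; last exact: nth_index.
  by rewrite nth_default // leqNgt index_mem; case/andP: us.
- by move=> v; rewrite cV ltnS index_size.
- move=> v va; case: pickP => [w /andP[gw /implyP]|no] //=.
  by case: (nb v va) => -[w]; rewrite no.
- move=> v va; case: pickP => [w /andP[gw /implyP]|no] //=.
  by case: (nb v va) => _ [w]; rewrite no.
Qed.
End Orders.

(** * Reaching the canonical tree *)

Section Canonical.
Variables (V : finType) (g : rel V) (a : V).
Hypotheses (g_sym : symmetric g) (g_irr : irreflexive g).
Variables (sigma : V -> nat) (lo hi : V -> V).
Hypotheses (sigma_inj : injective sigma) (sigma_lt : forall v, sigma v < #|V|).
Hypothesis loP :
  forall v, v != a -> g v (lo v) /\ (lo v != a -> sigma (lo v) < sigma v).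
Hypothesis hiP :
  forall v, v != a -> g v (hi v) /\ (hi v != a -> sigma v < sigma (hi v)).

Notation tree p := (parent_tree a setT p).
Notation rooted := (rooted g a).
Notation reach := (reach g a).

(** The last clause, read contrapositively, makes [D] closed under descendants. *)
Definition low_on (D : {set V}) (p : {ffun V -> V}) :=
  [/\ rooted p, a \notin D, forall v, v \in D -> p v = lo v &
      forall v, v \notin D -> p v \notin D].

Lemma low_on_raise (D : {set V}) (p : {ffun V -> V}) m :
  low_on D p ->
  let q := [ffun v => if (v \in D) && (m < sigma v) then hi v else p v] in
  rooted q /\ reach #|V| (tree p) (tree q).
Proof.
case=> rp aD pD pnD q; set n := #|V|.
(* After [k] steps the positions from [n - k] upwards are treated, so step [k] handles position
   [n - k.+1]. *)
pose P k := [ffun v =>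
  if [&& v \in D, m < sigma v & n - k <= sigma v] then hi v else p v].
have P0 : P 0 = p.
  by apply/ffunP=> v; rewrite ffunE subn0 [n <= _]leqNgt sigma_lt !andbF.
have Pn : P n = q by apply/ffunP=> v; rewrite !ffunE subnn andbT.
rewrite -{1}P0 -Pn; apply: sweep; rewrite ?P0 // => k kn.
have [/existsP[x /and3P[xD mx /eqP xk]]|no] :=
  boolP [exists x, [&& x \in D, m < sigma x & sigma x == n - k.+1]]; last first.
  left; apply/ffunP=> v; rewrite !ffunE.
  move/existsPn/(_ v): no; case: (v \in D) => //=.
  case: (m < sigma v) => //= ne; congr (if _ then _ else _); lia.
have xa : x != a by apply: contraNneq aD => <-.
right; exists x; split=> //.
(* [x] has no child: a raised [u] lies above [x] and points higher, any other [u] in [D] lies at or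
   below [x] and points lower, and no parent of a vertex outside [D] is in [D]. *)
- move=> u; rewrite ffunE; case: ifP => [/and3P[uD mu ku]|H]; apply/eqP=> e.
    have [_] := hiP (memPn aD u uD); rewrite e => /(_ xa); lia.
  have [uD|uD] := boolP (u \in D); last by have := pnD u uD; rewrite e xD.
  move: H; rewrite uD /=; have [_] := loP (memPn aD u uD).
  by rewrite -(pD u uD) e => /(_ xa); lia.
- move=> u ux; rewrite !ffunE; congr (if _ then _ else _).
  have : sigma u != sigma x by rewrite (inj_eq sigma_inj).
  by case: (u \in D) => //=; lia.
- by rewrite ffunE xD mx xk leqnn; case: (hiP xa).
Qed.

Lemma low_on_extend (D : {set V}) (p : {ffun V -> V}) x0 :
  low_on D p -> x0 \notin D -> x0 != a ->
  exists c q, [/\ c \notin D, low_on (c |: D) q &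
                  reach (#|V| + #|V|) (tree p) (tree q)].
Proof.
move=> Dp x0D x0a; have [rp aD pD pnD] := Dp.
have [pa gp [r rr]] := rp.
have Px0 : (x0 \notin D) && (x0 != a) by rewrite x0D.
(* Maximal rank leaves [c] without children outside [D]. *)
have [c /andP[cD ca] cmax] :=
  @arg_maxnP _ x0 [pred x | (x \notin D) && (x != a)] r Px0.
have leafc u : u \notin D -> p u != c.
  move=> uD; have [->|ua] := eqVneq u a; first by rewrite pa eq_sym.
  apply/eqP=> e; have := rr u ua; rewrite e.
  by have := cmax u; rewrite !inE uD ua /= => /(_ isT); lia.
have [] := low_on_raise (sigma c) Dp; set q := finfun _ => rq Rq.
set n := #|V|.
(* Upward sweep: it is idle before time [sigma c], moves [c] at that time, then lowers each raised
   vertex at the time equal to its position. *)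
pose P k := [ffun v => if v \in D then
    if (sigma c < sigma v) && (k <= sigma v) then hi v else lo v
  else if (v == c) && (sigma c < k) then lo v else p v].
have P0 : P 0 = q.
  apply/ffunP=> v; rewrite !ffunE andbT andbF.
  by case: (boolP (v \in D)) => //= vD; rewrite pD.
have PD k v : v \in D ->
    P k v = if (sigma c < sigma v) && (k <= sigma v) then hi v else lo v.
  by rewrite ffunE => ->.
have PnD k v : v \notin D -> v != c -> P k v = p v.
  by rewrite ffunE => /negPf -> /negPf ->.
have Pc k : P k c = if sigma c < k then lo c else p c.
  by rewrite ffunE (negPf cD) eqxx.
(* At the turn of [x], members of [D] still raised point above [x] or to [a], and those using [lo]
   point below [x] or to [a]. The choice of [c] and the closure of [D] settle the remaining
   vertices. *)
have leaf x : x \in c |: D -> sigma c <= sigma x -> forall u, P (sigma x) u != x.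
  move=> xcD cx u; apply/eqP.
  have xa : x != a.
    by move: xcD; rewrite !inE => /orP[/eqP->//|]; exact: memPn.
  have [uD|uD] := boolP (u \in D).
    have ua := memPn aD u uD.
    rewrite PD //; case: ifP => H e.
      by have [_] := hiP ua; rewrite e => /(_ xa); lia.
    have [_] := loP ua; rewrite e => /(_ xa); lia.
  have [->|uc] := eqVneq u c.
    rewrite Pc; case: ifP => H e.
      by have [_] := loP ca; rewrite e => /(_ xa); lia.
    have xc : x = c by apply: sigma_inj; lia.
    by have := leafc c cD; rewrite e xc eqxx.
  rewrite PnD // => e; move: xcD; rewrite -e in_setU1 (negPf (leafc u uD)) /=.
  by rewrite (negPf (pnD u uD)).
have [rPn RPn] : rooted (P n) /\ reach n (tree (P 0)) (tree (P n)).
  apply: sweep => //; last by rewrite P0.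
  move=> k kn.
  have [/existsP[x /and3P[xD cx /eqP xk]]|no] :=
    boolP [exists x, [&& x \in c |: D, sigma c <= sigma x & sigma x == k]].
    have xa : x != a.
      by move: xD; rewrite !inE => /orP[/eqP->//|]; exact: memPn.
    right; exists x; rewrite -xk; split=> //; first exact: leaf.
    - move=> u ux; have : sigma u != sigma x by rewrite (inj_eq sigma_inj).
      have [uD|uD] := boolP (u \in D).
        by move=> ne; rewrite !PD //; congr (if _ then _ else _); lia.
      have [->|uc] := eqVneq u c; last by rewrite !PnD.
      by move=> ne; rewrite !Pc; congr (if _ then _ else _); lia.
    suff -> : P (sigma x).+1 x = lo x by case: (loP xa).
    move: xD; rewrite in_setU1 => /predU1P[->|xD]; first by rewrite Pc ltnSn.
    by rewrite PD // ltnn andbF.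
  left; apply/ffunP=> v; move/existsPn/(_ v): no; rewrite in_setU1.
  have [vD|vD] := boolP (v \in D).
    rewrite orbT /= => ne; rewrite !PD //; congr (if _ then _ else _); lia.
  have [->|vc] := eqVneq v c; last by rewrite !PnD.
  by rewrite leqnn /= => ne; rewrite !Pc; congr (if _ then _ else _); lia.
exists c, (P n); split=> //; last by apply: reach_trans RPn; rewrite P0.
split=> //; first by rewrite !inE negb_or eq_sym ca.
- move=> v; rewrite in_setU1 => /predU1P[->|vD]; first by rewrite Pc sigma_lt.
  by rewrite PD // [n <= _]leqNgt sigma_lt andbF.
- move=> v; rewrite !in_setU1 negb_or => /andP[vc vD].
  by rewrite PnD // negb_or leafc // pnD.
Qed.

Lemma reach_low (p : {ffun V -> V}) : rooted p ->
  reach (2 * #|V| ^ 2) (tree p) (tree lo).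
Proof.
move=> rp.
suff H k : k < #|V| -> exists D q,
    [/\ low_on D q, #|D| = k & reach (k * (2 * #|V|)) (tree p) (tree q)].
  have V0 : 0 < #|V| by apply/card_gt0P; exists a.
  have [|D [q [[_ aD qD _] cD R]]] := H #|V|.-1; first by rewrite prednK.
  have DE : D = [set~ a].
    by apply/eqP; rewrite eqEcard cardsC1 cD leqnn subsetC sub1set inE aD.
  (* [lo a] is unconstrained, but [parent_tree] reads no parent at [a], so agreement off [a]
     suffices. *)
  have <- : tree q = tree lo.
    apply: eq_in_imset => v; rewrite !inE andbT => va.
    by rewrite qD // DE !inE.
  by apply: reach_leq R; rewrite expnS expn1; nia.
elim: k => [|k IH] kV.
  exists set0, p; split; rewrite ?cards0 //; last exact: reach_refl.
  by split; rewrite ?inE // => v; rewrite !inE.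
have [D [q [lq cD R]]] := IH (ltnW kV).
have [x xD] : exists x, x \notin a |: D.
  apply/existsP; rewrite -negb_forall; apply: contraL kV => /forallP full.
  rewrite -leqNgt -cD -addn1 addnC -(cards1 a).
  apply: leq_trans (leq_card_setU _ _); apply: subset_leq_card.
  by apply/subsetP=> z _.
move: xD; rewrite in_setU1 negb_or => /andP[xa xD].
have [c [q' [cnD lq' R']]] := low_on_extend lq xD xa.
exists (c |: D), q'; split=> //; first by rewrite cardsU1 cnD cD.
by have := reach_trans R R'; rewrite addnn -mul2n -mulSnr.
Qed.

End Canonical.

(* The sequence is T = T_0, T_1, ..., T_k = T' with (T :: s) = [T_0; ...; T_k]. *)
Theorem theorem1 :
  exists C : nat, 0 < C /\
    forall (V : finType) (g : rel V) (a : V),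
      symmetric g -> irreflexive g -> 2 <= #|V| -> two_connected g ->
      forall T T' : {set {set V}},
        spanning_tree g T -> spanning_tree g T' ->
        exists s : seq {set {set V}},
          [/\ size (T :: s) <= C * #|V| ^ 2,
              forall S, S \in s -> spanning_tree g S,
              forall i, i < size s ->
                adjacent_trees a (nth T (T :: s) i) (nth T s i) &
              last T s = T'].
Proof.
(* Both trees are within [2 * #|V| ^ 2] moves of the common tree; the fifth square absorbs the extra
   1 from counting trees instead of moves. *)
exists 5; split=> // V g a g_sym g_irr V2 g2 T T' sT sT'.
have [sigma [lo [hi [sI sl loP hiP]]]] := st_order a g_sym g2.
have [p [rp Tp]] := spanning_rooted a g_sym sT.
have [p' [rp' Tp']] := spanning_rooted a g_sym sT'.
have := reach_low g_sym g_irr sI sl loP hiP rp; rewrite -Tp => R.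
have := reach_low g_sym g_irr sI sl loP hiP rp'; rewrite -Tp' => R'.
have [s [ss sp adj ls]] := reach_seq (reach_trans R (reach_sym sT' R')).
exists s; split=> //=.
apply: leq_ltn_trans ss _; rewrite -mulnDl ltn_pmul2r // expn_gt0.
by rewrite (ltnW V2).
Qed.
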